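(* For every polymatroid $P\subset\mathbb{Z}^n$, the following identity of formal power series in $u,v$ holds: $$\widetilde{\mathscr{T}}_P(u,v)=\mathscr{T}_P\!\left(\frac{1}{1-u},\frac{1}{1-v}\right),$$ where $\widetilde{\mathscr{T}}_P(u,v)=\sum_{\mathbf c\in\mathbb{Z}^n}u^{d_1^{>}(P,\mathbf c)}\,v^{d_1^{<}(P,\mathbf c)}$, and $\frac1{1-u}$, $\frac1{1-v}$ stand for the geometric series $\sum_{k\ge0}u^k$, $\sum_{k\ge0}v^k$.
   Context: Notation: $[n]=\{1,\dots,n\}$; $\mathbf e_1,\dots,\mathbf e_n$ is the canonical basis of $\mathbb{R}^n$. A polymatroid in $\mathbb{Z}^n$ is a finite nonempty set $P\subset\mathbb{Z}^n$ satisfying the Exchange Axiom: for any $\mathbf a,\mathbf b\in P$ and any $i\in[n]$ with $a_i>b_i$, there exists $j\in[n]$ such that $a_j<b_j$ and both $\mathbf a-\mathbf e_i+\mathbf e_j$ and $\mathbf b+\mathbf e_i-\mathbf e_j$ belong to $P$. For $\mathbf a\in P$, an index $i\in[n]$ is internally active if there is no $j<i$ with $\mathbf a-\mathbf e_i+\mathbf e_j\in P$, and externally active if there is no $j<i$ with $\mathbf a+\mathbf e_i-\mathbf e_j\in P$. Let $\mathrm{Int}(\mathbf a),\mathrm{Ext}(\mathbf a)\subseteq[n]$ be the sets of internally, respectively externally, active indices. The polymatroid Tutte polynomial is $$\mathscr{T}_P(x,y)=\sum_{\mathbf a\in P}x^{|\mathrm{Int}(\mathbf a)\setminus\mathrm{Ext}(\mathbf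 a)|}\,y^{|\mathrm{Ext}(\mathbf a)\setminus\mathrm{Int}(\mathbf a)|}\,(x+y-1)^{|\mathrm{Int}(\mathbf a)\cap\mathrm{Ext}(\mathbf a)|}.$$ For $\mathbf a,\mathbf b\in\mathbb{R}^n$: $d_1^{>}(\mathbf a,\mathbf b)=\sum_{i:\,a_i>b_i}(a_i-b_i)$ and $d_1^{<}(\mathbf a,\mathbf b)=\sum_{i:\,a_i<b_i}(b_i-a_i)$. For $\mathbf c\in\mathbb{Z}^n$: $d_1^{>}(P,\mathbf c)=\min_{\mathbf a\in P}d_1^{>}(\mathbf a,\mathbf c)$ and $d_1^{<}(P,\mathbf c)=\min_{\mathbf a\in P}d_1^{<}(\mathbf a,\mathbf c)$. *)

(* Defs.v *)
From HB Require Import structures.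
From mathcomp Require Import all_boot all_order all_algebra.
From mathcomp Require Import finmap mpoly.
From mathcomp Require Import boolp classical_sets functions cardinality fsbigop.

Set Implicit Arguments.
Unset Strict Implicit.
Unset Printing Implicit Defensive.

Import Order.TTheory GRing.Theory Num.Theory.
Local Open Scope ring_scope.

(* [scoef f i j] is the coefficient of u^i v^j. *)
Record series := Series { scoef : nat -> nat -> int }.

HB.instance Definition _ := gen_eqMixin series.
HB.instance Definition _ := gen_choiceMixin series.

Lemma seriesP (f g : series) :
  (forall i j, scoef f i j = scoef g i j) -> f = g.
Proof.
case: f g => [f] [g] /= fg; congr Series.
by apply/funext => i; apply/funext => j.
Qed.

Definition series_zero := Series (fun _ _ => 0).
Definition series_one := Series (fun i j => ((i == 0%N) && (j == 0%N))%:R).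
Definition series_opp (f : series) := Series (fun i j => - scoef f i j).
Definition series_add (f g : series) :=
  Series (fun i j => scoef f i j + scoef g i j).
Definition series_mul (f g : series) :=
  Series (fun i j => \sum_(a < i.+1) \sum_(b < j.+1)
    scoef f a b * scoef g (i - a)%N (j - b)%N).

Fact series_addA : associative series_add.
Proof. by move=> f g h; apply: seriesP => i j /=; rewrite addrA. Qed.
Fact series_addC : commutative series_add.
Proof. by move=> f g; apply: seriesP => i j /=; rewrite addrC. Qed.
Fact series_add0 : left_id series_zero series_add.
Proof. by move=> f; apply: seriesP => i j /=; rewrite add0r. Qed.
Fact series_addN : left_inverse series_zero series_opp series_add.
Proof. by move=> f; apply: seriesP => i j /=; rewrite addNr. Qed.

HB.instance Definition _ := GRing.isZmodule.Build series
  series_addA series_addC series_add0 series_addN.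

(* The ring axioms are transported from {poly {poly int}}. *)
Definition series_agree (N : nat) (f : series) (p : {poly {poly int}}) :=
  forall i j, (i < N)%N -> (j < N)%N -> p`_i`_j = scoef f i j.

Definition series_trunc (N : nat) (f : series) : {poly {poly int}} :=
  \poly_(i < N) \poly_(j < N) scoef f i j.

Lemma series_agree_trunc N f : series_agree N f (series_trunc N f).
Proof. by move=> i j iN jN; rewrite coef_poly iN coef_poly jN. Qed.

Lemma series_agree1 N : series_agree N series_one 1.
Proof.
by move=> i j iN jN /=; rewrite coef1; case: eqP => _; rewrite ?coef1 ?coef0.
Qed.

Lemma series_agree_mul N f g p q : series_agree N f p -> series_agree N g q ->
  series_agree N (series_mul f g) (p * q).
Proof.
move=> fp gq i j iN jN /=; rewrite coefM coef_sum; apply: eq_bigr => a _.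
rewrite coefM; apply: eq_bigr => b _; rewrite fp ?gq //.
- exact: leq_ltn_trans (leq_subr _ _) iN.
- exact: leq_ltn_trans (leq_subr _ _) jN.
- by apply: leq_ltn_trans iN; rewrite -ltnS.
- by apply: leq_ltn_trans jN; rewrite -ltnS.
Qed.

Lemma series_agree_eq f g :
  (forall N, exists2 p, series_agree N f p & series_agree N g p) -> f = g.
Proof.
move=> fg; apply: seriesP => i j.
have [p fp gp] := fg (maxn i j).+1.
by rewrite -fp ?gp // ltnS (leq_maxl, leq_maxr).
Qed.

Fact series_mulA : associative series_mul.
Proof.
move=> f g h; apply: series_agree_eq => N.
pose t := series_trunc N; have tP := @series_agree_trunc N.
exists (t f * (t g * t h)); first by do 2?apply: series_agree_mul; apply: tP.
by rewrite mulrA; do 2?apply: series_agree_mul; apply: tP.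
Qed.

Fact series_mulC : commutative series_mul.
Proof.
move=> f g; apply: series_agree_eq => N.
pose t := series_trunc N; have tP := @series_agree_trunc N.
exists (t f * t g); first by apply: series_agree_mul; apply: tP.
by rewrite mulrC; apply: series_agree_mul; apply: tP.
Qed.

Fact series_mul1 : left_id series_one series_mul.
Proof.
move=> f; apply: series_agree_eq => N.
pose t := series_trunc N; have tP := @series_agree_trunc N.
exists (1 * t f); last by rewrite mul1r; apply: tP.
by apply: series_agree_mul; [apply: series_agree1|apply: tP].
Qed.

Fact series_mulDl : left_distributive series_mul series_add.
Proof.
move=> f g h; apply: seriesP => i j /=.
rewrite -big_split; apply: eq_bigr => a _ /=.
by rewrite -big_split; apply: eq_bigr => b _ /=; rewrite mulrDl.
Qed.

Fact series_1_neq0 : series_one != 0.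
Proof. by apply/eqP => /(congr1 (fun f => scoef f 0 0)). Qed.

HB.instance Definition _ := GRing.Zmodule_isComNzRing.Build series
  series_mulA series_mulC series_mul1 series_mulDl series_1_neq0.

Definition seriesU : series := Series (fun i j => ((i == 1%N) && (j == 0%N))%:R).
Definition seriesV : series := Series (fun i j => ((i == 0%N) && (j == 1%N))%:R).

Definition summable (I : choiceType) (F : I -> series) : Prop :=
  forall k l, finite_set [set x | scoef (F x) k l != 0]%classic.

(* The coefficientwise sum; it is meaningful only for summable families, as
   [\sum_(x \in A) _] is 0 by convention when the support is infinite. *)
Definition series_sum (I : choiceType) (F : I -> series) : series :=
  Series (fun k l => \sum_(x \in [set: I]) scoef (F x) k l).

Definition geometric (w : series) : series := series_sum (fun k : nat => w ^+ k).

Lemma scoefM (f g : series) i j : scoef (f * g) i j =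
  \sum_(a < i.+1) \sum_(b < j.+1) scoef f a b * scoef g (i - a)%N (j - b)%N.
Proof. by []. Qed.

Lemma scoef_mulU f i j :
  scoef (seriesU * f) i j = if i is i'.+1 then scoef f i' j else 0.
Proof.
have E : series_agree (maxn i j).+1 (seriesU * f)
    ('X * series_trunc (maxn i j).+1 f).
  apply: series_agree_mul; last exact: series_agree_trunc.
  move=> a b _ _ /=; rewrite coefX.
  by case: eqP => _; rewrite ?coef1 ?coef0.
rewrite -E ?ltnS ?leq_maxl ?leq_maxr // coefXM.
case: i {E} => [|i] /=; first by rewrite coef0.
rewrite series_agree_trunc // ltnS ?leq_maxr //.
by apply: leq_trans (leq_maxl _ _); rewrite leqnSn.
Qed.

Lemma scoef_mulV f i j :
  scoef (seriesV * f) i j = if j is j'.+1 then scoef f i j' else 0.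
Proof.
have E : series_agree (maxn i j).+1 (seriesV * f)
    ('X%:P * series_trunc (maxn i j).+1 f).
  apply: series_agree_mul; last exact: series_agree_trunc.
  move=> a b _ _ /=; rewrite coefC.
  by case: eqP => _; rewrite ?coefX ?coef0.
rewrite -E ?ltnS ?leq_maxl ?leq_maxr // coefCM coefXM.
case: j {E} => [|j] //=.
rewrite series_agree_trunc // ltnS ?leq_maxl //.
by apply: leq_trans (leq_maxr _ _); rewrite leqnSn.
Qed.

Lemma scoef_monomial k l i j :
  scoef (seriesU ^+ k * seriesV ^+ l) i j = ((i == k) && (j == l))%:R.
Proof.
elim: k i => [|k IHk] i.
  rewrite mul1r; elim: l j => [|l IHl] j //.
  by rewrite exprS scoef_mulV; case: j => [|j]; rewrite ?IHl ?andbF.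
by rewrite exprS -mulrA scoef_mulU; case: i => [|i]; rewrite ?IHk.
Qed.

Lemma summable_geomU : summable (fun k => seriesU ^+ k).
Proof.
move=> i j; apply: (@sub_finite_set _ _ [set i]%classic) => // k /=.
by have := scoef_monomial k 0 i j; rewrite mulr1 => ->; case: (i =P k).
Qed.

Lemma summable_geomV : summable (fun k => seriesV ^+ k).
Proof.
move=> i j; apply: (@sub_finite_set _ _ [set j]%classic) => // k /=.
have := scoef_monomial 0 k i j; rewrite mul1r => ->.
by case: (j =P k) => // _; rewrite andbF.
Qed.

Lemma scoef_geomU i j : scoef (geometric seriesU) i j = (j == 0%N)%:R.
Proof.
rewrite /= (fsbigTE [fset i]%fset) => [|k].
  rewrite big_seq_fset1.
  by have := scoef_monomial i 0 i j; rewrite mulr1 eqxx.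
rewrite inE => /negbTE ki.
by have := scoef_monomial k 0 i j; rewrite mulr1 eq_sym ki.
Qed.

Lemma scoef_geomV i j : scoef (geometric seriesV) i j = (i == 0%N)%:R.
Proof.
rewrite /= (fsbigTE [fset j]%fset) => [|k].
  rewrite big_seq_fset1.
  by have := scoef_monomial 0 j i j; rewrite mul1r eqxx andbT.
rewrite inE => /negbTE kj.
by have := scoef_monomial 0 k i j; rewrite mul1r [j == k]eq_sym kj andbF.
Qed.

Lemma geomUE : (1 - seriesU) * geometric seriesU = 1.
Proof.
apply: seriesP => i j; rewrite mulrBl mul1r.
have -> : forall f g, scoef (f - g) i j = scoef f i j - scoef g i j by [].
rewrite scoef_mulU; case: i => [|i]; rewrite !scoef_geomU ?subr0 //=.
by rewrite subrr.
Qed.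

Lemma geomVE : (1 - seriesV) * geometric seriesV = 1.
Proof.
apply: seriesP => i j; rewrite mulrBl mul1r.
have -> : forall f g, scoef (f - g) i j = scoef f i j - scoef g i j by [].
rewrite scoef_mulV; case: j => [|j]; rewrite !scoef_geomV ?subr0 //=.
  by rewrite andbT.
by rewrite subrr andbF.
Qed.

Notation evec i := (delta_mx 0 i : 'rV[int]_ _).

Definition polymatroid (n : nat) (P : {fset 'rV[int]_n}) : Prop :=
  P != fset0 /\
  forall (a b : 'rV[int]_n) (i : 'I_n), a \in P -> b \in P -> b 0 i < a 0 i ->
    exists j : 'I_n, [/\ a 0 j < b 0 j,
      a - evec i + evec j \in P & b + evec i - evec j \in P].

Definition Int_act (n : nat) (P : {fset 'rV[int]_n}) (a : 'rV[int]_n)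
    : {set 'I_n} :=
  [set i : 'I_n | ~~ [exists j : 'I_n, (j < i)%N && (a - evec i + evec j \in P)]].

Definition Ext_act (n : nat) (P : {fset 'rV[int]_n}) (a : 'rV[int]_n)
    : {set 'I_n} :=
  [set i : 'I_n | ~~ [exists j : 'I_n, (j < i)%N && (a + evec i - evec j \in P)]].

Definition tutte (n : nat) (P : {fset 'rV[int]_n}) : {mpoly int[2]} :=
  let x : {mpoly int[2]} := 'X_(inord 0) in
  let y : {mpoly int[2]} := 'X_(inord 1) in
  \sum_(a <- P) x ^+ #|Int_act P a :\: Ext_act P a|
              * y ^+ #|Ext_act P a :\: Int_act P a|
              * (x + y - 1) ^+ #|Int_act P a :&: Ext_act P a|.

Definition eval_series (p : {mpoly int[2]}) (x y : series) : series :=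
  mmap (intr : int -> series) (fun i : 'I_2 => if i == 0 then x else y) p.

Definition d1gt (R : realDomainType) (n : nat) (a b : 'rV[R]_n) : R :=
  \sum_(i < n | b 0 i < a 0 i) (a 0 i - b 0 i).

Definition d1lt (R : realDomainType) (n : nat) (a b : 'rV[R]_n) : R :=
  \sum_(i < n | a 0 i < b 0 i) (b 0 i - a 0 i).

(* [head 0 P] belongs to P when P is nonempty, so the default value does not
   interfere with the minimum (see [minsetP]). *)
Definition minset (n : nat) (P : {fset 'rV[int]_n}) (f : 'rV[int]_n -> int) : int :=
  \big[Num.min/f (head 0 P)]_(a <- P) f a.

Definition d1gtP (n : nat) (P : {fset 'rV[int]_n}) (c : 'rV[int]_n) : int :=
  minset P (fun a => d1gt a c).

Definition d1ltP (n : nat) (P : {fset 'rV[int]_n}) (c : 'rV[int]_n) : int :=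
  minset P (fun a => d1lt a c).

(* Both distances are nonnegative ([d1gtP_ge0], [d1ltP_ge0]), so taking
   absolute values only turns them into natural numbers. *)
Definition tutte_tilde_term (n : nat) (P : {fset 'rV[int]_n}) (c : 'rV[int]_n)
    : series :=
  seriesU ^+ `|d1gtP P c|%N * seriesV ^+ `|d1ltP P c|%N.

Definition tutte_tilde (n : nat) (P : {fset 'rV[int]_n}) : series :=
  series_sum (tutte_tilde_term P).

Lemma eval_seriesE (n : nat) (P : {fset 'rV[int]_n}) (x y : series) :
  eval_series (tutte P) x y =
  \sum_(a <- P) x ^+ #|Int_act P a :\: Ext_act P a|
              * y ^+ #|Ext_act P a :\: Int_act P a|
              * (x + y - 1) ^+ #|Int_act P a :&: Ext_act P a|.
Proof.
rewrite /eval_series /tutte; set h := (fun i : 'I_2 => _).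
have h0 : h (inord 0) = x by rewrite /h -val_eqE /= inordK.
have h1 : h (inord 1) = y by rewrite /h -val_eqE /= inordK.
rewrite raddf_sum /=; apply: eq_bigr => a _.
by rewrite !rmorphM !rmorphXn /= rmorphB rmorphD rmorph1 /= !mmapX !mmap1U h0 h1.
Qed.

Lemma minset_le (n : nat) (P : {fset 'rV[int]_n}) f a :
  a \in P -> minset P f <= f a.
Proof. by move=> aP; exact: (@bigmin_inf_seq _ _ _ _ _ a xpredT (f a) f aP). Qed.

Lemma minsetP (n : nat) (P : {fset 'rV[int]_n}) f : P != fset0 ->
  exists2 a, a \in P & minset P f = f a /\ forall b, b \in P -> f a <= f b.
Proof.
move=> P0.
have [a aP fa] : exists2 a, a \in P & minset P f = f a.
  rewrite /minset big_seq; elim/big_ind: _ => [|x y [a aP ->] [b bP ->]|a aP].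
  - exists (head 0 P) => //; case/fset0Pn: P0 => c cP.
    have: c \in enum_fset P by [].
    suff: c \in enum_fset P -> head 0 (enum_fset P) \in enum_fset P by apply.
    by case: (enum_fset P) => //= d s _; rewrite mem_head.
  - by rewrite /Num.min; case: ifP => _; [exists a|exists b].
  - by exists a.
by exists a => //; split=> // b bP; rewrite -fa minset_le.
Qed.

Lemma d1gt_ge0 (R : realDomainType) (n : nat) (a b : 'rV[R]_n) : 0 <= d1gt a b.
Proof. by apply: sumr_ge0 => i /ltW; rewrite subr_ge0. Qed.

Lemma d1lt_ge0 (R : realDomainType) (n : nat) (a b : 'rV[R]_n) : 0 <= d1lt a b.
Proof. by apply: sumr_ge0 => i /ltW; rewrite subr_ge0. Qed.

Lemma d1gtP_ge0 (n : nat) (P : {fset 'rV[int]_n}) c :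
  P != fset0 -> 0 <= d1gtP P c.
Proof.
by move/minsetP=> /(_ (fun a => d1gt a c))[a _ [e _]]; rewrite /d1gtP e d1gt_ge0.
Qed.

Lemma d1ltP_ge0 (n : nat) (P : {fset 'rV[int]_n}) c :
  P != fset0 -> 0 <= d1ltP P c.
Proof.
by move/minsetP=> /(_ (fun a => d1lt a c))[a _ [e _]]; rewrite /d1ltP e d1lt_ge0.
Qed.

Lemma d1gt_coord (R : realDomainType) (n : nat) (a b : 'rV[R]_n) i :
  a 0 i - d1gt a b <= b 0 i.
Proof.
rewrite lerBlDl -lerBlDr; case: (ltP (b 0 i) (a 0 i)) => [ba|ab].
  rewrite /d1gt (bigD1 i) //= lerDl.
  by apply: sumr_ge0 => j /andP[/ltW]; rewrite subr_ge0.
by rewrite (le_trans _ (d1gt_ge0 a b)) // subr_le0.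
Qed.

Lemma d1lt_coord (R : realDomainType) (n : nat) (a b : 'rV[R]_n) i :
  b 0 i <= a 0 i + d1lt a b.
Proof.
rewrite -lerBlDl; case: (ltP (a 0 i) (b 0 i)) => [ab|ba].
  rewrite /d1lt (bigD1 i) //= lerDl.
  by apply: sumr_ge0 => j /andP[/ltW]; rewrite subr_ge0.
by rewrite (le_trans _ (d1lt_ge0 a b)) // subr_le0.
Qed.

Lemma finite_box (n M : nat) :
  finite_set [set c : 'rV[int]_n | forall i, `|c 0 i| <= M%:Z]%classic.
Proof.
pose g (f : {ffun 'I_n -> 'I_(M + M).+1}) : 'rV[int]_n :=
  \row_i ((f i : nat)%:Z - M%:Z).
apply: (sub_finite_set _ (finite_image g (@finite_finset _ [set: _]%classic))).
move=> c /= cM; exists [ffun i => inord (absz (c 0 i + M%:Z))] => //.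
apply/rowP => i; rewrite mxE ffunE.
have /andP[lo hi] : (- M%:Z <= c 0%R i <= M%:Z)%R by rewrite -ler_norml.
have p0 : 0 <= c 0 i + M%:Z by rewrite -lerBlDr sub0r.
rewrite inordK; first by rewrite gez0_abs // addrK.
by rewrite ltnS -lez_nat gez0_abs // PoszD lerD2r.
Qed.

Lemma summable_tutte_tilde (n : nat) (P : {fset 'rV[int]_n}) :
  P != fset0 -> summable (tutte_tilde_term P).
Proof.
move=> P0 k l.
pose M := (k + l + \sum_(a <- P) \sum_(i < n) `|a 0%R i|)%N.
apply: (sub_finite_set _ (@finite_box n M)) => c ck i.
have {}ck : scoef (tutte_tilde_term P c) k l != 0 := ck.
rewrite /tutte_tilde_term scoef_monomial in ck.
have {ck}[ek el] : k = `|d1gtP P c|%N /\ l = `|d1ltP P c|%N.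
  by move: ck; case: (k =P _) => //; case: (l =P _).
have [a aP [ea _]] := minsetP (fun a => d1gt a c) P0.
have [b bP [eb _]] := minsetP (fun a => d1lt a c) P0.
have kE : k%:Z = d1gt a c by rewrite ek gez0_abs ?d1gtP_ge0.
have lE : l%:Z = d1lt b c by rewrite el gez0_abs ?d1ltP_ge0.
have bd x : x \in P -> `|x 0 i| <= (\sum_(a <- P) \sum_(i < n) `|a 0%R i|)%N%:Z.
  move=> xP; rewrite -abszE lez_nat (big_rem x) //= (bigD1 i) //=.
  by rewrite -addnA leq_addr.
have := d1gt_coord a c i; have := d1lt_coord b c i; rewrite -kE -lE.
have := bd _ aP; have := bd _ bP; rewrite /M !ler_norml !PoszD.
move: (Posz (\sum_(_ <- _) _)%N) => S /andP[_ b1] /andP[a1 _] c1 c2.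
apply/andP; split.
  rewrite !opprD (le_trans _ c2) // -addrA addrC lerD2r (le_trans _ a1) //.
  by rewrite gerDr oppr_le0.
by rewrite (le_trans c1) // [leRHS]addrC lerD // lerDr.
Qed.

(* Main.v *)
Require Import Defs.
From mathcomp Require Import all_boot all_order all_algebra finmap.
From mathcomp Require Import classical_sets fsbigop.
From mathcomp Require Import zify.

(** The lattice Z^n is tiled by cells, one for each point [a] of [P]: the cell of
    [a] is [a] plus a product of coordinate sets, where coordinate [i] may go
    down exactly when [i] is internally active at [a], and up exactly when [i]
    is externally active at [a].  The identity is the generating function of
    this tiling.

    Uniqueness of the cell containing a point [c]: if [a <> b] both have [c] in
    their cells, apply the exchange axiom at the largest index [i] where they
    differ.  The index [j] it returns is smaller than [i], so the exchange shows
    that [i] is inactive at [a] and at [b] in just the directions that would let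
    the two cells meet ([top_exchange], [cell_uniq]).  Existence: weight the
    coordinates by an increasing function and take the point of [P] nearest to
    [c] for the weighted l1 distance; an exchange contradicting activity would
    bring it closer to [c] ([cell_exists]).

    If [c] lies in the cell of [a], then [a] realises both distances from [P] to
    [c] at once: any other [b] in [P] can be moved one step towards [a] by a top
    exchange, and activity at [a] guarantees that neither distance to [c] grows
    ([cell_closer], [cell_nearest], [cell_dist]).  Hence the sum over the cell
    of [a] of the monomials u^d v^e is a product over the coordinates of
    one-dimensional sums ([cell_prod]), which are
    - 1/(1-u) for an index that is only internally active,
    - 1/(1-v) for an index that is only externally active,
    - 1/(1-u) + 1/(1-v) - 1 for an index active in both ways,
    - 1 for an inactive index.
    Their product is the term of [a] in the Tutte polynomial
    ([prod_axis_series]).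

    The rearrangement of the infinite sum is done one coefficient at a time: for
    a fixed coefficient only the points [c] of a large box contribute, and over
    a box the distributivity of a product over sums is a finite identity. *)

Set Implicit Arguments.
Unset Strict Implicit.
Unset Printing Implicit Defensive.

Import Order.TTheory GRing.Theory Num.Theory.
Local Open Scope ring_scope.

(** * Exchanges and the tiling of the lattice by cells *)

(** Every distance used below is a sum of functions of single coordinates, so an
    exchange changes it only through the two coordinates involved. *)
Lemma sum_exchange (n : nat) (f : 'I_n -> int -> int) (a : 'rV[int]_n)
    (i j : 'I_n) : i != j ->
  \sum_k f k ((a - evec i + evec j) 0 k) =
  \sum_k f k (a 0 k) + (f i (a 0 i - 1) - f i (a 0 i))
                     + (f j (a 0 j + 1) - f j (a 0 j)).
Proof.
move=> ij; have ji : j != i by rewrite eq_sym.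
rewrite (bigD1 i) //= (bigD1 j) //= [in RHS](bigD1 i) //= [in RHS](bigD1 j) //=.
rewrite !mxE !eqxx (negbTE ij) (negbTE ji) /= subr0 addr0.
under eq_bigr => k /andP[ki kj].
  rewrite !mxE (negbTE ki) (negbTE kj) !andbF subr0 addr0; over.
move: (f i (a 0 i - 1)) (f j (a 0 j + 1)) (f i (a 0 i)) (f j (a 0 j)) => * /=.
lia.
Qed.

(** Exchanging at the largest index [i] where [a] and [b] differ forces the
    partner [j] to be smaller, which is what activity quantifies over. *)
Lemma top_exchange (n : nat) (P : {fset 'rV[int]_n}) (a b : 'rV[int]_n) :
  polymatroid P -> a \in P -> b \in P -> a != b ->
  exists i j : 'I_n, (j < i)%N /\
    ([/\ b 0 i < a 0 i, a 0 j < b 0 j,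
         a - evec i + evec j \in P & b + evec i - evec j \in P]
  \/ [/\ a 0 i < b 0 i, b 0 j < a 0 j,
         b - evec i + evec j \in P & a + evec i - evec j \in P]).
Proof.
move=> [_ exch] aP bP /eqP/eqP ab.
have /existsP[i0 di0] : [exists i, a 0 i != b 0 i].
  apply: contra_neqT ab; rewrite negb_exists => /forallP e.
  by apply/rowP => i; apply/eqP; have := e i; rewrite negbK.
case: (@arg_maxnP _ i0 (fun i => a 0 i != b 0 i) (@nat_of_ord n) di0) => i di imax.
have below j : a 0 j != b 0 j -> j != i -> (j < i)%N.
  by move=> dj ji; rewrite ltn_neqAle; apply/andP; split=> //; exact: imax.
have lt_neq (x y : 'rV[int]_n) (j k : 'I_n) :
    x 0 j < y 0 j -> y 0 k < x 0 k -> j != k.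
  by move=> xy yx; apply: contraTneq xy => ->; rewrite -leNgt ltW.
exists i; case: (ltgtP (a 0 i) (b 0 i)) di => // lt_i _.
- have [j [lt_j ? ?]] := exch b a i bP aP lt_i.
  exists j; split; last by right.
  by apply: below; [rewrite gt_eqF|exact: lt_neq lt_j lt_i].
- have [j [lt_j ? ?]] := exch a b i aP bP lt_i.
  exists j; split; last by left.
  by apply: below; [rewrite lt_eqF|exact: lt_neq lt_j lt_i].
Qed.

Definition cell (n : nat) (P : {fset 'rV[int]_n}) (a c : 'rV[int]_n) : bool :=
  [forall i, ((c 0 i < a 0 i) ==> (i \in Int_act P a)) &&
             ((a 0 i < c 0 i) ==> (i \in Ext_act P a))].

Lemma cell_ge (n : nat) (P : {fset 'rV[int]_n}) (a c : 'rV[int]_n)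
    (i j : 'I_n) : cell P a c -> (j < i)%N -> a - evec i + evec j \in P ->
  a 0 i <= c 0 i.
Proof.
move=> /forallP/(_ i)/andP[/implyP down _] ji aP; rewrite leNgt.
apply/negP => /down; rewrite inE => /negP; apply.
by apply/existsP; exists j; rewrite ji.
Qed.

Lemma cell_le (n : nat) (P : {fset 'rV[int]_n}) (a c : 'rV[int]_n)
    (i j : 'I_n) : cell P a c -> (j < i)%N -> a + evec i - evec j \in P ->
  c 0 i <= a 0 i.
Proof.
move=> /forallP/(_ i)/andP[_ /implyP up] ji aP; rewrite leNgt.
apply/negP => /up; rewrite inE => /negP; apply.
by apply/existsP; exists j; rewrite ji.
Qed.

Lemma cell_uniq (n : nat) (P : {fset 'rV[int]_n}) (a b c : 'rV[int]_n) :
  polymatroid P -> a \in P -> b \in P -> cell P a c -> cell P b c -> a = b.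
Proof.
move=> PP aP bP ac bc; apply/eqP/negP => /negP ab.
have [i [j [ji [[lt _ a' b']|[lt _ b' a']]]]] := top_exchange PP aP bP ab.
- have := cell_ge ac ji a'; have := cell_le bc ji b'; lia.
- have := cell_ge bc ji b'; have := cell_le ac ji a'; lia.
Qed.

(** Moving coordinate [i] one unit towards [c] gains its weight [i.+1], more
    than the weight that any [j < i] can cost. *)
Lemma cell_exists (n : nat) (P : {fset 'rV[int]_n}) (c : 'rV[int]_n) :
  polymatroid P -> exists2 a, a \in P & cell P a c.
Proof.
move=> [P0 _].
pose h (i : 'I_n) (t : int) : int := i.+1%:Z * `|t - c 0 i|.
have [a aP [_ amin]] := Defs.minsetP (fun a => \sum_i h i (a 0 i)) P0.
exists a => //; apply/forallP => i; apply/andP; split; apply/implyP => lt_i;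
  rewrite inE; apply/negP => /existsP[j /andP[ji a'P]];
  have ij : i != j by rewrite neq_ltn ji orbT.
- have := amin _ a'P; rewrite sum_exchange // /h; nia.
- have := amin _ a'P; rewrite addrAC sum_exchange 1?eq_sym // /h; nia.
Qed.

Lemma d1gtE (n : nat) (b c : 'rV[int]_n) :
  d1gt b c = \sum_i Num.max 0 (b 0 i - c 0 i).
Proof.
rewrite /d1gt big_mkcond /=; apply: eq_bigr => i _; case: ifP; lia.
Qed.

Lemma d1ltE (n : nat) (b c : 'rV[int]_n) :
  d1lt b c = \sum_i Num.max 0 (c 0 i - b 0 i).
Proof.
rewrite /d1lt big_mkcond /=; apply: eq_bigr => i _; case: ifP; lia.
Qed.

(** At the top index [i], inactivity at [a] puts [c] on the far side of [a] as
    seen from [b]; so moving [b] one unit towards [a] in coordinate [i] lowers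
    one of the two distances to [c] by 1.  This pays for the only possible loss,
    which is at most 1, in the same distance, and comes from coordinate [j]. *)
Lemma cell_closer (n : nat) (P : {fset 'rV[int]_n}) (a b c : 'rV[int]_n) :
  polymatroid P -> a \in P -> b \in P -> a != b -> cell P a c ->
  exists2 b', b' \in P &
    [/\ \sum_i `|b' 0 i - a 0 i| < \sum_i `|b 0 i - a 0 i|,
        d1gt b' c <= d1gt b c & d1lt b' c <= d1lt b c].
Proof.
move=> PP aP bP ab ac.
have [i [j [ji [[lt_i lt_j a' b']|[lt_i lt_j b' a']]]]] := top_exchange PP aP bP ab;
  have ij : i != j by rewrite neq_ltn ji orbT.
- have ci := cell_ge ac ji a'.
  exists (b + evec i - evec j) => //; rewrite !d1gtE !d1ltE addrAC.
  rewrite (sum_exchange (fun k t => `|t - a 0 k|)) 1?eq_sym //.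
  rewrite (sum_exchange (fun k t => Num.max 0 (t - c 0 k))) 1?eq_sym //.
  rewrite (sum_exchange (fun k t => Num.max 0 (c 0 k - t))) 1?eq_sym //.
  by split; rewrite -addrA ?gerDl ?gtrDl; lia.
- have ci := cell_le ac ji a'.
  exists (b - evec i + evec j) => //; rewrite !d1gtE !d1ltE.
  rewrite (sum_exchange (fun k t => `|t - a 0 k|)) //.
  rewrite (sum_exchange (fun k t => Num.max 0 (t - c 0 k))) //.
  rewrite (sum_exchange (fun k t => Num.max 0 (c 0 k - t))) //.
  by split; rewrite -addrA ?gerDl ?gtrDl; lia.
Qed.

Lemma cell_nearest (n : nat) (P : {fset 'rV[int]_n}) (a b c : 'rV[int]_n) :
  polymatroid P -> a \in P -> b \in P -> cell P a c ->
  d1gt a c <= d1gt b c /\ d1lt a c <= d1lt b c.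
Proof.
move=> PP aP + ac.
have [m] := ubnP `|(\sum_i `|b 0 i - a 0 i|)%R|%N; elim: m b => // m IH b bm bP.
have [<-//|ab] := eqVneq a b.
have [b' b'P [dist gt_b lt_b]] := cell_closer PP aP bP ab ac.
have : 0 <= \sum_i `|b' 0 i - a 0 i| by apply: sumr_ge0.
move: dist bm; set x := \sum_i _; set y := \sum_i _ => xy ym x0.
have [|//|gt_a lt_a] := IH b'; first by rewrite -/x; lia.
by split; [exact: le_trans gt_b|exact: le_trans lt_b].
Qed.

Lemma cell_dist (n : nat) (P : {fset 'rV[int]_n}) (a c : 'rV[int]_n) :
  polymatroid P -> a \in P -> cell P a c ->
  d1gtP P c = d1gt a c /\ d1ltP P c = d1lt a c.
Proof.
move=> PP aP ac; split; apply/eqP; rewrite eq_le (minset_le _ aP) /=.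
- have [b bP [e _]] := Defs.minsetP (fun a => d1gt a c) PP.1.
  by rewrite /d1gtP e; case: (cell_nearest PP aP bP ac).
- have [b bP [e _]] := Defs.minsetP (fun a => d1lt a c) PP.1.
  by rewrite /d1ltP e; case: (cell_nearest PP aP bP ac).
Qed.

(** * The generating function of a cell *)

(** The factor that a coordinate with displacement [t] contributes to the
    monomial of a point of a cell; leaving the cell kills the whole product. *)
Definition axis_term (down up : bool) (t : int) : series :=
  if ((t < 0) ==> down) && ((0 < t) ==> up)
  then seriesU ^+ `|(Num.max 0 (- t))%R|%N * seriesV ^+ `|(Num.max 0 t)%R|%N else 0.

(** Both the cell condition and the exponents split over the coordinates. *)
Lemma cell_prod (n : nat) (P : {fset 'rV[int]_n}) (a c : 'rV[int]_n) :
  \prod_i axis_term (i \in Int_act P a) (i \in Ext_act P a) (c 0 i - a 0 i) =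
  if cell P a c then seriesU ^+ `|d1gt a c|%N * seriesV ^+ `|d1lt a c|%N else 0.
Proof.
have axis_ok i : (((c 0 i - a 0 i < 0) ==> (i \in Int_act P a)) &&
    ((0 < c 0 i - a 0 i) ==> (i \in Ext_act P a))) =
    (((c 0 i < a 0 i) ==> (i \in Int_act P a)) &&
             ((a 0 i < c 0 i) ==> (i \in Ext_act P a))).
  by rewrite subr_lt0 subr_gt0.
have sum_absz (f : 'I_n -> int) : (forall i, 0 <= f i) ->
    `|(\sum_i f i)%R|%N = (\sum_i `|f i|)%N.
  move=> f0; apply/eqP; rewrite -eqz_nat gez0_abs ?sumr_ge0 //.
  rewrite (big_morph Posz PoszD (erefl _)); apply/eqP; apply: eq_bigr => i _.
  by rewrite gez0_abs.
case: ifP => [/forallP ac|/negbT]; last first.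
  rewrite negb_forall => /existsP[i /negbTE off].
  by rewrite (bigD1 i) //= /axis_term axis_ok off mul0r.
rewrite d1gtE d1ltE !sum_absz => [|i|i]; try lia.
rewrite !expr_sum -big_split /=; apply: eq_bigr => i _.
by rewrite /axis_term axis_ok ac opprB.
Qed.

Lemma term_cells (n : nat) (P : {fset 'rV[int]_n}) (c : 'rV[int]_n) :
  polymatroid P -> tutte_tilde_term P c = \sum_(a <- P)
    \prod_i axis_term (i \in Int_act P a) (i \in Ext_act P a) (c 0 i - a 0 i).
Proof.
move=> PP; have [a aP ac] := cell_exists c PP.
rewrite (big_rem a) //= cell_prod ac big_seq big1 ?addr0.
  by rewrite /tutte_tilde_term; have [-> ->] := cell_dist PP aP ac.
move=> b; rewrite (mem_rem_uniq a (fset_uniq P)) => /andP[ba bP].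
rewrite cell_prod; case: ifP => // bc.
by rewrite (cell_uniq PP bP aP bc ac) eqxx in ba.
Qed.

(** * Coefficientwise summation over a box *)

Lemma fsum_image (I : finType) (T : choiceType) (h : I -> T) (F : T -> int) :
  injective h -> (forall x, F x != 0 -> exists i, x = h i) ->
  \sum_(x \in [set: T]) F x = \sum_i F (h i).
Proof.
move=> h_inj Fh; pose s := [seq h i | i <- enum I].
rewrite (fsbigTE (seq_fset tt s)) => [|x]; last first.
  rewrite seq_fsetE => /negP xs; apply/eqP/negP => /negP /Fh[i xi].
  by apply: xs; rewrite xi map_f ?mem_enum.
rewrite (perm_big s) ?big_map ?big_enum //=.
apply: uniq_perm; [exact: sort_keys_uniq|by rewrite map_inj_uniq ?enum_uniq|].
by move=> x; rewrite sort_keysE.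
Qed.

(** Congruence modulo the monomials that are not below [u^k v^l]; it allows the
    geometric series to be replaced by finite sums inside a product. *)
Definition agree_upto (k l : nat) (f g : series) : Prop :=
  forall i j, (i <= k)%N -> (j <= l)%N -> scoef f i j = scoef g i j.

Lemma agree_upto_prod (k l : nat) (I : finType) (f g : I -> series) :
  (forall i, agree_upto k l (f i) (g i)) ->
  agree_upto k l (\prod_i f i) (\prod_i g i).
Proof.
move=> fg; apply: (big_ind2 (agree_upto k l)) => // f1 g1 f2 g2 fg1 fg2 i j ik jl.
rewrite !scoefM; apply: eq_bigr => a _; apply: eq_bigr => b _.
have ai : (a <= i)%N := ltn_ord a; have bj : (b <= j)%N := ltn_ord b.
rewrite fg1 ?fg2 //; try exact: leq_trans (leq_subr _ _) _.
- exact: leq_trans ai ik.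
- exact: leq_trans bj jl.
Qed.

Lemma scoef_sum (I : Type) (r : seq I) (f : I -> series) (k l : nat) :
  scoef (\sum_(i <- r) f i) k l = \sum_(i <- r) scoef (f i) k l.
Proof. exact: (big_morph (fun f => scoef f k l)). Qed.

(** The monomial of displacement [t] is [u^k v^l] exactly when one exponent
    vanishes and [t = l - k], since [t] cannot go both down and up. *)
Lemma scoef_axis_term (down up : bool) (t : int) (k l : nat) :
  scoef (axis_term down up t) k l =
  ([&& (k == 0%N) || (l == 0%N), (0 < k)%N ==> down & (0 < l)%N ==> up] &&
   (t == l%:Z - k%:Z))%:R.
Proof.
rewrite /axis_term; case: ifP => ok.
  by rewrite scoef_monomial; congr (nat_of_bool _)%:R; lia.
set b := (X in X%:R); suff -> : b = false by [].
by rewrite /b; lia.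
Qed.

(** The sum of [axis_term down up t] over all integers [t].  When both directions
    are open, [t = 0] is counted by both geometric series, hence the [- 1]. *)
Definition axis_series (down up : bool) : series :=
  if down
  then if up then geometric seriesU + geometric seriesV - 1
       else geometric seriesU
  else if up then geometric seriesV else 1.

(** The window of [t] is wide enough to contain, for each coefficient up to
    [(k, l)], the only displacement that produces it; the shift by [s] lets a
    single box serve the cells of all the points of [P]. *)
Lemma sum_axis_term (down up : bool) (M k l : nat) (s : int) :
  (k + l + `|s| <= M)%N ->
  agree_upto k l (\sum_(t < (M + M).+1) axis_term down up (t%:Z - M%:Z - s))
    (axis_series down up).
Proof.
move=> kls i j ik jl; rewrite scoef_sum.
have t0P : (`|(j%:Z - i%:Z + M%:Z + s)%R| < (M + M).+1)%N by lia.
rewrite (bigD1 (Ordinal t0P)) //= big1 ?addr0 => [|t /eqP tt0].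
  rewrite scoef_axis_term /axis_series.
  have -> : (`|(j%:Z - i%:Z + M%:Z + s)%R|%N%:Z - M%:Z - s == j%:Z - i%:Z) by lia.
  have scoefB f g : scoef (f - g) i j = scoef f i j - scoef g i j by [].
  have scoefD f g : scoef (f + g) i j = scoef f i j + scoef g i j by [].
  case: down; case: up; rewrite ?scoefB ?scoefD ?scoef_geomU ?scoef_geomV /=;
    case: i {ik t0P scoefB scoefD} => [|i]; by case: j {jl} => [|j].
rewrite scoef_axis_term; case: (_ =P j%:Z - i%:Z) => [e|_]; last by rewrite andbF.
by case: tt0; apply: val_inj => /=; lia.
Qed.

Lemma prod_axis_series (n : nat) (A B : {set 'I_n}) :
  \prod_i axis_series (i \in A) (i \in B) =
  geometric seriesU ^+ #|A :\: B| * geometric seriesV ^+ #|B :\: A|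
  * (geometric seriesU + geometric seriesV - 1) ^+ #|A :&: B|.
Proof.
have powE (x : series) (C : {set 'I_n}) : x ^+ #|C| = \prod_i x ^+ (i \in C).
  rewrite prodrXr -sum1_card [in LHS]big_mkcond.
  by congr (_ ^+ _); apply: eq_bigr => i _; case: (i \in C).
rewrite !powE -!big_split /=; apply: eq_bigr => i _; rewrite !inE /axis_series.
by case: (i \in A); case: (i \in B) => /=; rewrite ?mulr1 ?mul1r.
Qed.

Definition box_point (n M : nat) (f : {ffun 'I_n -> 'I_(M + M).+1}) : 'rV[int]_n :=
  \row_i ((f i)%:Z - M%:Z).

Lemma box_point_inj (n M : nat) : injective (@box_point n M).
Proof.
move=> f g /rowP fg; apply/ffunP => i; apply: val_inj.
by have := fg i; rewrite !mxE /=; lia.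
Qed.

Lemma box_pointP (n M : nat) (c : 'rV[int]_n) :
  (forall i, `|c 0 i| <= M%:Z) -> exists f, c = @box_point n M f.
Proof.
move=> cM; exists [ffun i => inord `|(c 0 i + M%:Z)%R|%N].
apply/rowP => i; rewrite mxE ffunE; have := cM i => ci.
by rewrite inordK; lia.
Qed.

Lemma coord_bound (n : nat) (P : {fset 'rV[int]_n}) :
  exists S : nat, forall a i, a \in P -> (`|a 0%R i| <= S)%N.
Proof.
exists (\sum_(a <- P) \sum_i `|a 0%R i|)%N => a i aP.
by rewrite (big_rem a) //= (bigD1 i) //= -addnA leq_addr.
Qed.

Theorem theorem10p6 (n : nat) (P : {fset 'rV[int]_n}) :
  polymatroid P ->
  tutte_tilde P = eval_series (tutte P) (geometric seriesU) (geometric seriesV).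
Proof.
move=> PP; rewrite eval_seriesE; apply: seriesP => k l.
(* A point at distances [k] and [l] from some [a] in [P] has coordinates bounded
   by [k + l] plus those of [a]. *)
have [S aS] := coord_bound P; pose M := (k + l + S)%N.
rewrite -[LHS]/(\sum_(c \in [set: 'rV[int]_n]%classic)
  scoef (tutte_tilde_term P c) k l).
rewrite (fsum_image (@box_point_inj n M)) => [|c].
  under eq_bigr => f _ do rewrite term_cells // scoef_sum.
  rewrite exchange_big scoef_sum; apply: eq_big_seq => a aP.
  rewrite -scoef_sum -prod_axis_series.
  pose F i (t : 'I_(M + M).+1) :=
    axis_term (i \in Int_act P a) (i \in Ext_act P a) (t%:Z - M%:Z - a 0 i).
  have -> : \sum_f \prod_i axis_term (i \in Int_act P a) (i \in Ext_act P a)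
      (@box_point n M f 0 i - a 0 i) = \prod_i \sum_t F i t.
    rewrite bigA_distr_bigA; apply: eq_bigr => f _.
    by apply: eq_bigr => i _; rewrite mxE.
  apply: (agree_upto_prod (k := k) (l := l)) => // i; apply: sum_axis_term.
  by rewrite leq_add2l aS.
move=> ck; apply: box_pointP => i.
have [a aP ac] := cell_exists c PP.
move: ck; rewrite /tutte_tilde_term scoef_monomial.
have [-> ->] := cell_dist PP aP ac.
case: andP => // -[/eqP kE /eqP lE] _.
have := aS a i aP; have := d1gt_coord a c i; have := d1lt_coord a c i.
have := d1gt_ge0 a c; have := d1lt_ge0 a c.
rewrite /M; move: (d1gt a c) (d1lt a c) kE lE => d e kE lE.
by move: (a 0 i) (c 0 i) => x y; lia.
Qed.
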